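(* The simple modules of $A_1=U(\mathfrak{gl}(P))e$ are a $2$-dimensional family of modules with underlying object $P$ parametrized by $a,b\in k$, denoted $L(1,a,b)$. The $\mathfrak{gl}(P)$-action on $L(1,a,b)$ is $$y\mapsto\begin{pmatrix}b&0\\0&b+1\end{pmatrix},\quad x\mapsto\begin{pmatrix}0&1\\ a&0\end{pmatrix},\quad y'\mapsto\begin{pmatrix}0&0\\1&0\end{pmatrix}$$ (with $e$ acting by the identity).
   Context: Let $k$ be an algebraically closed field of characteristic $2$. $\mathrm{Ver}_4^+$ is the symmetric tensor category whose objects are finite-dimensional $k$-vector spaces with an endomorphism $d$, $d^2=0$ (write $v'=dv$), with $d$ acting on tensor products by $d\otimes1+1\otimes d$ and braiding $c(v\otimes w)=w\otimes v+w'\otimes v'$; $P=k[d]/d^2$ is the two-dimensional object with basis $1,d$, and dual basis $1^*,d^*$ of $P^*$. $\mathfrak{gl}(P)=P\otimes P^*$ has bracket $[A,B]=AB-BA-B'A'$ and basis $x=1\otimes d^*$, $x'=e=1\otimes1^*+d\otimes d^*$, $y=1\otimes1^*$, $y'=d\otimes1^*$, where $dx=e$, $dy=y'$, $de=dy'=0$. Its universal enveloping algebra $U(\mathfrak{gl}(P))$ (the quotient of the tensor algebra by $a\otimes b-b\otimes a-b'\otimes a'=[a,b]$) is the algebra generated by $x,y,e,y'$ with $e$ central, $e^2=e$, $(y')^2=0$, $xy'+y'x=e$, $yy'+y'y=y'$, $xy+yx=x+y'+y'e$. So $e$ is a central idempotent; put $A_1=U(\mathfrak{gl}(P))e$ and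 $A_0=U(\mathfrak{gl}(P))(1-e)$. Modules are considered in $\mathrm{Ver}_4^+$: objects $M$ with an action morphism $U(\mathfrak{gl}(P))\otimes M\to M$ in $\mathrm{Ver}_4^+$. *)

(* Defs.v *)
From HB Require Import structures.
From mathcomp Require Import all_boot all_order all_algebra.
From mathcomp Require Import boolp.
Set Implicit Arguments.
Unset Strict Implicit.
Unset Printing Implicit Defensive.
Import GRing.Theory.
Local Open Scope ring_scope.
Local Open Scope quotient_scope.

(** * Objects, algebras and modules in Ver_4^+ *)

(* In characteristic 2 the tensor product V (x) W carries d (x) 1 + 1 (x) d, so
   a morphism V (x) W -> Z is a bilinear map satisfying the Leibniz rule.  The
   braiding of Ver_4^+ enters neither the notion of (associative, unital)
   algebra nor that of module; it only appears in [Urel_env] below. *)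

Record verObj (k : fieldType) := VerObj {
  vobj :> vectType k;
  vdif : {linear vobj -> vobj};
  vdifK : forall v, vdif (vdif v) = 0 }.

Arguments vdif {k} V : rename.

(* Possibly infinite-dimensional: an algebra in the ind-completion. *)
Record verAlg (k : fieldType) := VerAlg {
  valg :> algType k;
  adif : {linear valg -> valg};
  adifK : forall u, adif (adif u) = 0;
  adifM : forall u v, adif (u * v) = adif u * v + u * adif v }.

Arguments adif {k} A : rename.

Record verMod (k : fieldType) (A : verAlg k) (V : verObj k) := VerMod {
  mact :> A -> V -> V;
  mact_linear_l : forall v, linear (mact ^~ v);
  mact_linear_r : forall u, linear (mact u);
  mact1 : forall v, mact 1 v = v;
  mactM : forall u1 u2 v, mact (u1 * u2) v = mact u1 (mact u2 v);
  mact_dif : forall u v, vdif V (mact u v) = mact (adif A u) v + mact u (vdif V v) }.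

Definition submodule (k : fieldType) (A : verAlg k) (V : verObj k)
    (M : verMod A V) (W : {vspace V}) : Prop :=
  (forall v, v \in W -> vdif V v \in W) /\
  (forall u v, v \in W -> M u v \in W).

Definition simple_module (k : fieldType) (A : verAlg k) (V : verObj k)
    (M : verMod A V) : Prop :=
  (fullv : {vspace V}) <> 0%VS /\
  forall W : {vspace V}, submodule M W -> W = 0%VS \/ W = fullv.

Definition module_iso (k : fieldType) (A : verAlg k) (V W : verObj k)
    (M : verMod A V) (N : verMod A W) : Prop :=
  exists f : {linear V -> W},
    [/\ bijective f, forall v, f (vdif V v) = vdif W (f v)
      & forall u v, f (M u v) = N u (f v)].

(** * The object P and the Lie algebra gl(P) *)

Definition mx2 (k : fieldType) (a b c d : k) : 'M[k]_2 :=
  \matrix_(i < 2, j < 2) nth 0 (nth [::] [:: [:: a; b]; [:: c; d]] i) j.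

Section GL.
Variable k : fieldType.

(* P is the space of column vectors; its basis (1, d) is the standard one, so
   that a matrix acts on P on the left and E_ij = e_i (x) e_j^*. *)
Definition dP : 'M[k]_2 := mx2 0 0 1 0.

Lemma dP_sqr : dP * dP = 0.
Proof.
apply/matrixP => i j; rewrite /dP /mx2 !mxE !big_ord_recl big_ord0 !mxE /=.
by case: i j => [[|[|//]] ?] [[|[|//]] ?] /=; rewrite ?(mulr0, mul0r, addr0).
Qed.

Fact mulmx_dPK (v : 'cV[k]_2) : dP *m (dP *m v) = 0.
Proof. by rewrite mulmxA [dP *m dP]dP_sqr mul0mx. Qed.

Definition P : verObj k :=
  @VerObj k 'cV[k]_2 (mulmx dP : {linear 'cV[k]_2 -> 'cV[k]_2}) mulmx_dPK.

(* d on P (x) P^*, where d f = f \o d for f in P^* (characteristic 2). *)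
Definition gl_dif (A : 'M[k]_2) : 'M[k]_2 := dP * A + A * dP.

Lemma gl_difL : linear gl_dif.
Proof.
move=> a A B; rewrite /gl_dif mulrDr mulrDl -scalerAr -scalerAl scalerDr.
by rewrite addrACA.
Qed.

HB.instance Definition _ := GRing.isLinear.Build k
  'M[k]_2 'M[k]_2 _ gl_dif gl_difL.

Definition gl_br (A B : 'M[k]_2) : 'M[k]_2 :=
  A * B - B * A - gl_dif B * gl_dif A.

Definition gl_x : 'M[k]_2 := mx2 0 1 0 0.
Definition gl_e : 'M[k]_2 := 1.
Definition gl_y : 'M[k]_2 := mx2 1 0 0 0.
Definition gl_y' : 'M[k]_2 := mx2 0 0 1 0.

End GL.

(** * The universal enveloping algebra U(gl(P)) *)

(* Formal expressions over gl(P), and the least congruence making them a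
   k-algebra in which [Tgen] is linear (this yields the tensor algebra of gl(P))
   and satisfies a (x) b - b (x) a - b' (x) a' = [a, b]. *)
Inductive texpr (k : fieldType) : Type :=
| Tgen of 'M[k]_2
| Tcst of k
| Tadd of texpr k & texpr k
| Tmul of texpr k & texpr k.

Section Env.
Variable k : fieldType.
Local Notation T := (texpr k).

Definition Topp (s : T) : T := Tmul (Tcst (-1)) s.
Definition Tsub (s t : T) : T := Tadd s (Topp t).

Inductive Urel : T -> T -> Prop :=
| Urel_refl s : Urel s s
| Urel_sym s t : Urel s t -> Urel t s
| Urel_trans s t u : Urel s t -> Urel t u -> Urel s u
| Urel_add s s' t t' : Urel s s' -> Urel t t' -> Urel (Tadd s t) (Tadd s' t')
| Urel_mul s s' t t' : Urel s s' -> Urel t t' -> Urel (Tmul s t) (Tmul s' t')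
| Urel_addA s t u : Urel (Tadd s (Tadd t u)) (Tadd (Tadd s t) u)
| Urel_addC s t : Urel (Tadd s t) (Tadd t s)
| Urel_add0 s : Urel (Tadd (Tcst 0) s) s
| Urel_addN s : Urel (Tadd (Topp s) s) (Tcst 0)
| Urel_mulA s t u : Urel (Tmul s (Tmul t u)) (Tmul (Tmul s t) u)
| Urel_mul1 s : Urel (Tmul (Tcst 1) s) s
| Urel_mulDl s t u : Urel (Tmul (Tadd s t) u) (Tadd (Tmul s u) (Tmul t u))
| Urel_mulDr s t u : Urel (Tmul s (Tadd t u)) (Tadd (Tmul s t) (Tmul s u))
| Urel_cstD a b : Urel (Tcst (a + b)) (Tadd (Tcst a) (Tcst b))
| Urel_cstM a b : Urel (Tcst (a * b)) (Tmul (Tcst a) (Tcst b))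
| Urel_cstC a s : Urel (Tmul (Tcst a) s) (Tmul s (Tcst a))
| Urel_genL a A B :
    Urel (Tgen (a *: A + B)) (Tadd (Tmul (Tcst a) (Tgen A)) (Tgen B))
| Urel_env A B :
    Urel (Tsub (Tsub (Tmul (Tgen A) (Tgen B)) (Tmul (Tgen B) (Tgen A)))
               (Tmul (Tgen (gl_dif B)) (Tgen (gl_dif A))))
         (Tgen (gl_br A B)).

HB.instance Definition _ := gen_eqMixin T.
HB.instance Definition _ := gen_choiceMixin T.

Definition Urelb (s t : T) : bool := `[< Urel s t >].

Lemma Urelb_refl : reflexive Urelb.
Proof. by move=> s; apply/asboolP; apply: Urel_refl. Qed.

Lemma Urelb_sym : symmetric Urelb.
Proof. by move=> s t; apply/asboolP/asboolP; apply: Urel_sym. Qed.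

Lemma Urelb_trans : transitive Urelb.
Proof.
by move=> t s u /asboolP st /asboolP tu; apply/asboolP; apply: Urel_trans tu.
Qed.

Canonical Urel_equiv := EquivRel Urelb Urelb_refl Urelb_sym Urelb_trans.

Definition Ugl := {eq_quot Urel_equiv}.
HB.instance Definition _ := Choice.on Ugl.

Definition Ucls (t : T) : Ugl := \pi_{eq_quot Urel_equiv} t.
Definition Urep (u : Ugl) : T := repr u.

Lemma UrepK u : Ucls (Urep u) = u. Proof. exact: reprK. Qed.

Lemma UclsP s t : Ucls s = Ucls t <-> Urel s t.
Proof.
split; last by move=> st; apply/eqmodP/asboolP.
by move=> /eqmodP /asboolP.
Qed.

Lemma Urep_cls t : Urel (Urep (Ucls t)) t.
Proof. by apply/UclsP; rewrite UrepK. Qed.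

Definition Uadd (u v : Ugl) := Ucls (Tadd (Urep u) (Urep v)).
Definition Umul (u v : Ugl) := Ucls (Tmul (Urep u) (Urep v)).
Definition Uopp (u : Ugl) := Ucls (Topp (Urep u)).
Definition Uscale (a : k) (u : Ugl) := Ucls (Tmul (Tcst a) (Urep u)).

Lemma Ucls_add s t : Ucls (Tadd s t) = Uadd (Ucls s) (Ucls t).
Proof. by apply/UclsP/Urel_sym/Urel_add; exact: Urep_cls. Qed.

Lemma Ucls_mul s t : Ucls (Tmul s t) = Umul (Ucls s) (Ucls t).
Proof. by apply/UclsP/Urel_sym/Urel_mul; exact: Urep_cls. Qed.

Lemma Uscale_mul a u : Uscale a u = Umul (Ucls (Tcst a)) u.
Proof. by rewrite /Uscale Ucls_mul UrepK. Qed.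

Lemma UaddA : associative Uadd.
Proof.
move=> u v w; rewrite -(UrepK u) -(UrepK v) -(UrepK w) -!Ucls_add.
by apply/UclsP; exact: Urel_addA.
Qed.

Lemma UaddC : commutative Uadd.
Proof.
move=> u v; rewrite -(UrepK u) -(UrepK v) -!Ucls_add.
by apply/UclsP; exact: Urel_addC.
Qed.

Lemma Uadd0 : left_id (Ucls (Tcst 0)) Uadd.
Proof.
by move=> u; rewrite -(UrepK u) -!Ucls_add; apply/UclsP; exact: Urel_add0.
Qed.

Lemma UaddN : left_inverse (Ucls (Tcst 0)) Uopp Uadd.
Proof.
move=> u; rewrite /Uopp -{2}(UrepK u) -!Ucls_add.
by apply/UclsP; exact: Urel_addN.
Qed.

HB.instance Definition _ := GRing.isZmodule.Build Ugl UaddA UaddC Uadd0 UaddN.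

Lemma UmulA : associative Umul.
Proof.
move=> u v w; rewrite -(UrepK u) -(UrepK v) -(UrepK w) -!Ucls_mul.
by apply/UclsP; exact: Urel_mulA.
Qed.

Lemma Umul1 : left_id (Ucls (Tcst 1)) Umul.
Proof.
by move=> u; rewrite -(UrepK u) -!Ucls_mul; apply/UclsP; exact: Urel_mul1.
Qed.

Lemma UcstC a u : Umul (Ucls (Tcst a)) u = Umul u (Ucls (Tcst a)).
Proof.
by rewrite -(UrepK u) -!Ucls_mul; apply/UclsP; exact: Urel_cstC.
Qed.

Lemma Umulr1 : right_id (Ucls (Tcst 1)) Umul.
Proof. by move=> u; rewrite -UcstC Umul1. Qed.

Lemma UmulDl : left_distributive Umul +%R.
Proof.
move=> u v w; rewrite /GRing.add /=.
rewrite -(UrepK u) -(UrepK v) -(UrepK w) -!(Ucls_add, Ucls_mul).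
by apply/UclsP; exact: Urel_mulDl.
Qed.

Lemma UmulDr : right_distributive Umul +%R.
Proof.
move=> u v w; rewrite /GRing.add /=.
rewrite -(UrepK u) -(UrepK v) -(UrepK w) -!(Ucls_add, Ucls_mul).
by apply/UclsP; exact: Urel_mulDr.
Qed.

Fixpoint teval (B : algType k) (f : 'M[k]_2 -> B) (t : T) : B :=
  match t with
  | Tgen A => f A
  | Tcst a => a%:A
  | Tadd s t => teval f s + teval f t
  | Tmul s t => teval f s * teval f t
  end.

Lemma teval_rel (B : algType k) (f : 'M[k]_2 -> B) : linear f ->
  (forall A A', f A * f A' - f A' * f A - f (gl_dif A') * f (gl_dif A)
                = f (gl_br A A')) ->
  forall s t, Urel s t -> teval f s = teval f t.
Proof.
move=> fL fE s t; elim=> //=.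
- by move=> {}s {}t u _ -> _ ->.
- by move=> {}s s' {}t t' _ -> _ ->.
- by move=> {}s s' {}t t' _ -> _ ->.
- by move=> *; rewrite addrA.
- by move=> *; rewrite addrC.
- by move=> *; rewrite scale0r add0r.
- by move=> *; rewrite scale0r scaleN1r mulN1r addNr.
- by move=> *; rewrite mulrA.
- by move=> *; rewrite scale1r mul1r.
- by move=> *; rewrite mulrDl.
- by move=> *; rewrite mulrDr.
- by move=> *; rewrite scalerDl.
- by move=> *; rewrite -scalerAl mul1r scalerA.
- by move=> *; rewrite mulr_algl mulr_algr.
- by move=> *; rewrite fL mulr_algl.
- by move=> A B'; rewrite !scaleN1r !mulN1r fE.
Qed.

(* The tautological action of gl(P) on P. *)
Lemma tevalP_rel s t : Urel s t ->
  teval (id : 'M[k]_2 -> 'M[k]_2) s = teval (id : 'M[k]_2 -> 'M[k]_2) t.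
Proof. by apply: teval_rel => // a A B. Qed.

Lemma Uone_neq0 : Ucls (Tcst 1) != 0.
Proof.
apply/eqP => /UclsP /tevalP_rel /= /eqP.
by rewrite scale1r scale0r oner_eq0.
Qed.

HB.instance Definition _ :=
  GRing.Zmodule_isNzRing.Build Ugl UmulA Umul1 Umulr1 UmulDl UmulDr Uone_neq0.

Lemma UclsD s t : Ucls (Tadd s t) = Ucls s + Ucls t.
Proof. exact: Ucls_add. Qed.

Lemma UclsM s t : Ucls (Tmul s t) = Ucls s * Ucls t.
Proof. exact: Ucls_mul. Qed.

Lemma UscaleE a u : Uscale a u = Ucls (Tcst a) * u.
Proof. exact: Uscale_mul. Qed.

Lemma UcstM a b : Ucls (Tcst (a * b)) = Ucls (Tcst a) * Ucls (Tcst b).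
Proof. by rewrite -UclsM; apply/UclsP; exact: Urel_cstM. Qed.

Lemma UcstD a b : Ucls (Tcst (a + b)) = Ucls (Tcst a) + Ucls (Tcst b).
Proof. by rewrite -UclsD; apply/UclsP; exact: Urel_cstD. Qed.

Lemma UscaleA a b u : Uscale a (Uscale b u) = Uscale (a * b) u.
Proof. by rewrite !UscaleE UcstM mulrA. Qed.

Lemma Uscale1 : left_id 1 Uscale.
Proof. by move=> u; rewrite UscaleE [_ * u]Umul1. Qed.

Lemma UscaleDr : right_distributive Uscale +%R.
Proof. by move=> a u v; rewrite !UscaleE mulrDr. Qed.

Lemma UscaleDl u : {morph Uscale^~ u : a b / a + b}.
Proof. by move=> a b; rewrite !UscaleE UcstD mulrDl. Qed.

HB.instance Definition _ :=
  GRing.Zmodule_isLmodule.Build k Ugl UscaleA Uscale1 UscaleDr UscaleDl.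

Lemma UscalerAl (a : k) (u v : Ugl) : a *: (u * v) = (a *: u) * v.
Proof. by rewrite /GRing.scale /= !UscaleE mulrA. Qed.

HB.instance Definition _ := GRing.Lmodule_isLalgebra.Build k Ugl UscalerAl.

Lemma UscalerAr (a : k) (u v : Ugl) : a *: (u * v) = u * (a *: v).
Proof.
rewrite /GRing.scale /= !UscaleE !mulrA; congr (_ * _).
exact: UcstC.
Qed.

HB.instance Definition _ := GRing.Lalgebra_isAlgebra.Build k Ugl UscalerAr.

Definition Ugen (A : 'M[k]_2) : Ugl := Ucls (Tgen A).

Lemma Ucst_alg a : Ucls (Tcst a) = a%:A.
Proof. by rewrite /GRing.scale /= UscaleE mulr1. Qed.

Lemma Ugen_linear : linear Ugen.
Proof.
move=> a A B; transitivity (Ucls (Tcst a) * Ugen A + Ugen B).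
  by rewrite -UclsM -UclsD; apply/UclsP; exact: Urel_genL.
by rewrite Ucst_alg mulr_algl.
Qed.

HB.instance Definition _ := GRing.isLinear.Build k 'M[k]_2 Ugl _ Ugen Ugen_linear.

Lemma Ugen_env A B :
  Ugen A * Ugen B - Ugen B * Ugen A - Ugen (gl_dif B) * Ugen (gl_dif A)
  = Ugen (gl_br A B).
Proof.
have /UclsP := Urel_env A B.
by rewrite /Tsub /Topp !(UclsD, UclsM, Ucst_alg) !scaleN1r !mulN1r.
Qed.

Lemma Uind (Q : Ugl -> Prop) :
  (forall A, Q (Ugen A)) -> (forall a, Q a%:A) ->
  (forall u v, Q u -> Q v -> Q (u + v)) ->
  (forall u v, Q u -> Q v -> Q (u * v)) -> forall u, Q u.
Proof.
move=> Qg Qc QD QM u; rewrite -(UrepK u); elim: (Urep u) => //.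
- by move=> a; rewrite Ucst_alg.
- by move=> s Qs t Qt; rewrite UclsD; apply: QD.
- by move=> s Qs t Qt; rewrite UclsM; apply: QM.
Qed.

(* The derivation of U(gl(P)) extending [gl_dif]. *)
Fixpoint Tdif (t : T) : T :=
  match t with
  | Tgen A => Tgen (gl_dif A)
  | Tcst _ => Tcst 0
  | Tadd s t => Tadd (Tdif s) (Tdif t)
  | Tmul s t => Tadd (Tmul (Tdif s) t) (Tmul s (Tdif t))
  end.

Definition Udif (u : Ugl) : Ugl := Ucls (Tdif (Urep u)).

End Env.

Arguments Ugl : clear implicits.

Section Char2.
Variables (k : fieldType) (char2 : 2%N \in [pchar k]).
Local Notation M2 := 'M[k]_2.

Let addkk (V : lmodType k) (v : V) : v + v = 0.
Proof.
by rewrite -mulr2n -scaler_nat (pcharf0 char2) scale0r.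
Qed.

Let oppk (V : lmodType k) (v : V) : - v = v.
Proof. by apply/esym/eqP; rewrite -addr_eq0 addkk. Qed.

Lemma gl_difK A : gl_dif (gl_dif A) = 0 :> M2.
Proof.
rewrite /gl_dif mulrDr mulrDl mulrA dP_sqr mul0r add0r -!mulrA dP_sqr mulr0.
by rewrite addr0 addkk.
Qed.

Lemma gl_difM A B : gl_dif (A * B) = gl_dif A * B + A * gl_dif B :> M2.
Proof.
rewrite /gl_dif mulrDl mulrDr !mulrA addrA; congr (_ + _).
by rewrite -addrA addkk addr0.
Qed.

Lemma gl_dif_br A B : gl_dif (gl_br A B) = gl_br (gl_dif A) B + gl_br A (gl_dif B) :> M2.
Proof.
rewrite /gl_br !gl_difK !oppk !(mulr0, mul0r, addr0).
rewrite !linearD /= !gl_difM !gl_difK !(mulr0, mul0r, addr0).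
by rewrite (AC (2*2) ((1*4)*(2*3))).
Qed.

Lemma Tdif_rel (s t : texpr k) : Urel s t -> Ucls (Tdif s) = Ucls (Tdif t).
Proof.
have C0 : Ucls (Tcst 0) = 0 :> Ugl k by [].
have CE := (@UclsD k, @UclsM k, C0, @Ucst_alg k, mul0r, mulr0, add0r, addr0).
elim=> {s t}; rewrite /Topp //=.
- by move=> s t u _ -> _ ->.
- by move=> s s' t t' _ es _ et; rewrite !CE es et.
- by move=> s s' t t' /UclsP ss' es /UclsP tt' et; rewrite !CE es et ss' tt'.
- by move=> s t u; rewrite !CE addrA.
- by move=> s t; rewrite !CE addrC.
- by move=> s; rewrite !CE.
- by move=> s; rewrite !CE scaleN1r mulN1r addNr.
- by move=> s t u; rewrite !CE mulrDl mulrDr !mulrA addrA.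
- by move=> s; rewrite !CE scale1r mul1r.
- by move=> s t u; rewrite !CE !mulrDl addrACA.
- by move=> s t u; rewrite !CE !mulrDr addrACA.
- by move=> a b; rewrite !CE.
- by move=> a b; rewrite !CE.
- by move=> a s; rewrite !CE mulr_algl mulr_algr.
- by move=> a A B; rewrite !CE -/(Ugen _) !linearP /= mulr_algl.
move=> A B; rewrite gl_dif_br !CE -!/(Ugen _) !gl_difK linear0 !CE.
rewrite [Ugen (gl_br _ _ + _)]linearD /= -!Ugen_env !gl_difK !linear0 !CE.
rewrite !scaleN1r !mulN1r !oppk !addr0.
by rewrite (AC (2*2) ((1*4)*(2*3))).
Qed.

Lemma Udif_cls t : Udif (Ucls t) = Ucls (Tdif t) :> Ugl k.
Proof. by apply: Tdif_rel; exact: Urep_cls. Qed.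

Lemma Udif_gen A : Udif (Ugen A) = Ugen (gl_dif A) :> Ugl k.
Proof. exact: Udif_cls. Qed.

Lemma UdifD u v : Udif (u + v) = Udif u + Udif v :> Ugl k.
Proof.
by rewrite -(UrepK u) -(UrepK v) -UclsD !Udif_cls -UclsD.
Qed.

Lemma UdifM u v : Udif (u * v) = Udif u * v + u * Udif v :> Ugl k.
Proof.
by rewrite -(UrepK u) -(UrepK v) -UclsM !Udif_cls /= UclsD !UclsM.
Qed.

Lemma Udif_alg a : Udif a%:A = 0 :> Ugl k.
Proof. by rewrite -Ucst_alg Udif_cls. Qed.

Lemma Udif_linear : linear (@Udif k).
Proof.
by move=> a u v; rewrite UdifD -mulr_algl UdifM Udif_alg mul0r add0r mulr_algl.
Qed.

Lemma UdifK (u : Ugl k) : Udif (Udif u) = 0.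
Proof.
apply: (@Uind k (fun u => Udif (Udif u) = 0)) u => [A|a|u v Eu Ev|u v Eu Ev].
- by rewrite !Udif_gen gl_difK linear0.
- by rewrite Udif_alg -(scale0r (1 : Ugl k)) Udif_alg scale0r.
- by rewrite !UdifD Eu Ev addr0.
by rewrite UdifM UdifD !UdifM Eu Ev mul0r mulr0 add0r addr0 addkk.
Qed.

Definition Udif_lin : {linear Ugl k -> Ugl k} :=
  HB.pack (@Udif k) (GRing.isLinear.Build k (Ugl k) (Ugl k) _ (@Udif k) Udif_linear).

Definition Uver : verAlg k := @VerAlg k (Ugl k) Udif_lin UdifK UdifM.

End Char2.

(** * The algebra A_1 = U(gl(P)) e *)

Section A1.
Variable k : fieldType.

Definition Ue : Ugl k := Ugen (gl_e k).

Lemma gl_dif_x : gl_dif (gl_x k) = gl_e k.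
Proof.
apply/matrixP => i j; rewrite /gl_dif /dP /gl_x /mx2 !mxE.
rewrite !big_ord_recl !big_ord0 !mxE /=.
by case: i j => [[|[|//]] ?] [[|[|//]] ?] /=;
   rewrite ?(mulr0, mul0r, addr0, add0r, mulr1).
Qed.

Lemma Ue_idem : Ue * Ue = Ue.
Proof.
have /eqP := Ugen_env (gl_x k) (gl_x k).
rewrite /gl_br !subrr !sub0r gl_dif_x mulr1  linearN /= eqr_opp.
by move/eqP.
Qed.

Variable char2 : 2%N \in [pchar k].
Local Notation U := (Uver char2).

Lemma gl_dif_e : gl_dif (gl_e k) = 0.
Proof. by rewrite -gl_dif_x (gl_difK char2). Qed.

Lemma Ue_comm (u : Ugl k) : Ue * u = u * Ue.
Proof.
apply: (@Uind k (fun u => Ue * u = u * Ue)) u => [A|a|u v Eu Ev|u v Eu Ev].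
- apply/eqP; rewrite -subr_eq0; have := Ugen_env (gl_e k) A.
  rewrite /gl_br gl_dif_e linear0 !mulr0 !subr0 mul1r mulr1 subrr linear0.
  by move=> ->.
- by rewrite mulr_algl mulr_algr.
- by rewrite mulrDl mulrDr Eu Ev.
by rewrite mulrA Eu -mulrA Ev mulrA.
Qed.

(* U(gl(P)) e is a unital algebra with unit e, not a unital subalgebra of
   U(gl(P)). *)
Definition in_A1 : pred U := fun u => `[< exists v, u = v * Ue >].

Lemma in_A1P u : reflect (u * Ue = u) (u \in in_A1).
Proof.
apply: (iffP (asboolP _)) => [[v ->]|uE]; first by rewrite -mulrA Ue_idem.
by exists u.
Qed.

Fact in_A1_closed : GRing.submod_closed in_A1.
Proof.
split; first by apply/in_A1P; rewrite mul0r.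
move=> a u v /in_A1P uE /in_A1P vE; apply/in_A1P.
by rewrite mulrDl -scalerAl uE vE.
Qed.
HB.instance Definition _ := GRing.isSubmodClosed.Build k U in_A1 in_A1_closed.

Record A1 := MkA1 { A1val :> U; A1P : A1val \in in_A1 }.

HB.instance Definition _ := [isSub for A1val].
HB.instance Definition _ := [Choice of A1 by <:].
HB.instance Definition _ := [SubChoice_isSubLmodule of A1 by <:].

Fact A1mul_subproof (u v : A1) : A1val u * A1val v \in in_A1.
Proof. by apply/in_A1P; rewrite -mulrA; congr (_ * _); apply/in_A1P/A1P. Qed.

Fact A1proj_subproof (u : U) : u * Ue \in in_A1.
Proof. by apply/in_A1P; rewrite -mulrA Ue_idem. Qed.

Fact A1e_subproof : Ue \in in_A1.
Proof. by apply/in_A1P; rewrite Ue_idem. Qed.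

Definition A1mul (u v : A1) : A1 := MkA1 (A1mul_subproof u v).
Definition A1one : A1 := MkA1 A1e_subproof.

Lemma A1mulA : associative A1mul.
Proof. by move=> u v w; apply/val_inj; exact: mulrA. Qed.

Lemma A1mul1r : right_id A1one A1mul.
Proof. by move=> u; apply/val_inj/in_A1P/A1P. Qed.

Lemma A1mul1l : left_id A1one A1mul.
Proof. by move=> u; apply/val_inj; rewrite /= Ue_comm; apply/in_A1P/A1P. Qed.

Lemma A1mulDl : left_distributive A1mul +%R.
Proof. by move=> u v w; apply/val_inj; exact: mulrDl. Qed.

Lemma A1mulDr : right_distributive A1mul +%R.
Proof. by move=> u v w; apply/val_inj; exact: mulrDr. Qed.

Lemma A1one_neq0 : A1one != 0.
Proof.
apply/eqP => /(congr1 (@A1val))/UclsP /tevalP_rel /= /eqP.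
by rewrite scale0r oner_eq0.
Qed.

HB.instance Definition _ :=
  GRing.Zmodule_isNzRing.Build A1 A1mulA A1mul1l A1mul1r A1mulDl A1mulDr
    A1one_neq0.

Lemma A1scalerAl (a : k) (u v : A1) : a *: (u * v) = (a *: u) * v.
Proof. by apply/val_inj; exact: scalerAl. Qed.

HB.instance Definition _ := GRing.Lmodule_isLalgebra.Build k A1 A1scalerAl.

Lemma A1scalerAr (a : k) (u v : A1) : a *: (u * v) = u * (a *: v).
Proof. by apply/val_inj; exact: scalerAr. Qed.

HB.instance Definition _ := GRing.Lalgebra_isAlgebra.Build k A1 A1scalerAr.

Lemma Udif_e : Udif Ue = 0.
Proof.
by rewrite /Ue (Udif_gen char2) gl_dif_e linear0.
Qed.

Fact A1dif_subproof (u : A1) : Udif (A1val u) \in in_A1.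
Proof.
have /in_A1P uE := A1P u.
by apply/in_A1P; rewrite -[in RHS]uE (UdifM char2) Udif_e mulr0 addr0.
Qed.

Definition A1dif (u : A1) : A1 := MkA1 (A1dif_subproof u).

Lemma A1dif_linear : linear A1dif.
Proof. by move=> a u v; apply/val_inj; exact: (Udif_linear char2). Qed.

Definition A1dif_lin : {linear A1 -> A1} :=
  HB.pack A1dif (GRing.isLinear.Build k A1 A1 _ A1dif A1dif_linear).

Lemma A1difK u : A1dif (A1dif u) = 0.
Proof. by apply/val_inj; exact: (UdifK char2). Qed.

Lemma A1difM u v : A1dif (u * v) = A1dif u * v + u * A1dif v.
Proof. by apply/val_inj; exact: (UdifM char2). Qed.

Definition A1ver : verAlg k := @VerAlg k A1 A1dif_lin A1difK A1difM.

(* The image of gl(P) in A_1: the element A of gl(P) acts on an A_1-module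
   through A e. *)
Definition A1gen (A : 'M[k]_2) : A1ver := MkA1 (A1proj_subproof (Ugen A)).

End A1.

(* Main.v *)
From HB Require Import structures.
Require Import Defs.
From mathcomp Require Import all_boot all_order all_algebra.
From mathcomp Require Import ring.
Set Implicit Arguments.
Unset Strict Implicit.
Unset Printing Implicit Defensive.
Import GRing.Theory.
Local Open Scope ring_scope.

(** Write n for the image of y' in A_1.  Since e becomes the unit, the relations
    of U(gl(P)) read x n + n x = 1, y n + n y = n, x y + y x = x and n^2 = 0.
    Three consequences determine the simple modules.

    The derivation d of A_1 is inner, d u = n u + u n, because this holds on
    the generators ([A1_dif_inner]).  So on a module V the operator
    T = d + n is an endomorphism of modules.  It has square zero, hence is not
    injective, and Schur's lemma forces T = 0 when V is simple: d acts as n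
    ([simple_A1_dif]).

    The elements x^2 and y + n x are central in A_1 ([A1_casimir_x],
    [A1_casimir_y]).  On a simple module over an algebraically closed field
    they act by scalars a and b ([simple_central_scalar]), and these scalars are
    isomorphism invariants.

    On L(1, a, b) the scalars are a and b.  Conversely let V be simple with
    scalars a and b, and pick v != 0 with n v = 0.  Then n x v = v, x x v = a v,
    and y = b + n x on V, so that sending the basis (1, d) of P to (x v, v)
    defines a nonzero morphism from L(1, a, b) to V.  As L(1, a, b) is simple
    too, Schur's lemma makes it an isomorphism ([simple_A1_iso]). *)

(** * Characteristic two *)

Section CharTwo.
Variables (k : fieldType) (char2 : 2%N \in [pchar k]) (V : lmodType k).
Implicit Types u v : V.

Lemma char2_addvv v : v + v = 0.
Proof. by rewrite -mulr2n -scaler_nat (pcharf0 char2) scale0r. Qed.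

Lemma char2_oppv v : - v = v.
Proof. by apply/esym/eqP; rewrite -addr_eq0 char2_addvv. Qed.

Lemma char2_addvK u v : u + v + v = u.
Proof. by rewrite -addrA char2_addvv addr0. Qed.

Lemma char2_addKv u v : v + (v + u) = u.
Proof. by rewrite addrA char2_addvv add0r. Qed.

Lemma char2_addv_eq u v w : u + v = w -> u = w + v.
Proof. by move=> <-; rewrite char2_addvK. Qed.

End CharTwo.

Lemma addr0_eq_char2 (R : nzRingType) (char2 : 2%N \in [pchar R]) (u v : R) :
  u + v = 0 -> u = v.
Proof. by move=> /eqP; rewrite addr_eq0 (oppr_pchar2 char2) => /eqP. Qed.

(** * Two by two matrices *)

Lemma ord2P (Q : 'I_2 -> Prop) : Q 0 -> Q 1 -> forall i, Q i.
Proof.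
move=> Q0 Q1 [[|[|//]] lti].
  by rewrite (_ : Ordinal _ = 0) //; apply/val_inj.
by rewrite (_ : Ordinal _ = 1) //; apply/val_inj.
Qed.

Section Mx2.
Variable k : fieldType.
Implicit Types (A : 'M[k]_2) (p q r s : k).

Lemma mx2_eta A : A = mx2 (A 0 0) (A 0 1) (A 1 0) (A 1 1).
Proof. by apply/matrixP; apply: ord2P; apply: ord2P; rewrite !mxE. Qed.

Lemma mx2D p q r s p' q' r' s' :
  mx2 p q r s + mx2 p' q' r' s' = mx2 (p + p') (q + q') (r + r') (s + s').
Proof. by apply/matrixP; apply: ord2P; apply: ord2P; rewrite !mxE. Qed.

Lemma mx2N p q r s : - mx2 p q r s = mx2 (- p) (- q) (- r) (- s).
Proof. by apply/matrixP; apply: ord2P; apply: ord2P; rewrite !mxE. Qed.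

Lemma mx2Z c p q r s : c *: mx2 p q r s = mx2 (c * p) (c * q) (c * r) (c * s).
Proof. by apply/matrixP; apply: ord2P; apply: ord2P; rewrite !mxE. Qed.

Lemma mx2M p q r s p' q' r' s' :
  mx2 p q r s * mx2 p' q' r' s' =
  mx2 (p * p' + q * r') (p * q' + q * s') (r * p' + s * r') (r * q' + s * s').
Proof.
by apply/matrixP; apply: ord2P; apply: ord2P;
  rewrite !mxE !big_ord_recl big_ord0 !mxE /= addr0.
Qed.

Lemma mx2_1 : mx2 1 0 0 1 = 1 :> 'M[k]_2.
Proof. by apply/matrixP; apply: ord2P; apply: ord2P; rewrite !mxE. Qed.

Lemma mx2_0 : mx2 0 0 0 0 = 0 :> 'M[k]_2.
Proof. by apply/matrixP; apply: ord2P; apply: ord2P; rewrite !mxE. Qed.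

Lemma mx2_dif p q r s : gl_dif (mx2 p q r s) = mx2 q 0 (p + s) q.
Proof.
by rewrite /gl_dif /dP !mx2M mx2D !(mul0r, mulr0, mul1r, mulr1, add0r, addr0).
Qed.

Lemma mulmx_mx2 p q r s (v : 'cV[k]_2) :
  ((mx2 p q r s *m v) 0 0 = p * v 0 0 + q * v 1 0) *
  ((mx2 p q r s *m v) 1 0 = r * v 0 0 + s * v 1 0).
Proof.
have E1 : lift 0 0 = 1 :> 'I_2 by apply/val_inj.
by split; rewrite !mxE !big_ord_recl big_ord0 !mxE /= addr0 E1.
Qed.

Lemma cV2P (u v : 'cV[k]_2) : u 0 0 = v 0 0 -> u 1 0 = v 1 0 -> u = v.
Proof. by move=> *; apply/matrixP; apply: ord2P => j; rewrite ord1. Qed.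

End Mx2.

(** * The modules L(1, a, b) *)

Section ModuleL.
Variables (k : fieldType) (char2 : 2%N \in [pchar k]) (a b : k).

(** The matrix by which A acts on L(1, a, b): the prescribed matrices of y, x
    and y', extended linearly, where E_22 = e - y acts by the diagonal matrix
    (b + 1, b). *)
Definition Lmx (A : 'M[k]_2) : 'M[k]_2 :=
  mx2 (A 0 0 * b + A 1 1 * (b + 1)) (A 0 1)
      (A 0 1 * a + A 1 0) (A 0 0 * (b + 1) + A 1 1 * b).

Lemma Lmx_mx2 p q r s :
  Lmx (mx2 p q r s) =
  mx2 (p * b + s * (b + 1)) q (q * a + r) (p * (b + 1) + s * b).
Proof. by rewrite /Lmx !mxE. Qed.

Lemma Lmx_linear : linear Lmx.
Proof.
move=> c A B; rewrite (mx2_eta A) (mx2_eta B) mx2Z mx2D !Lmx_mx2 mx2Z mx2D.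
by congr mx2; ring.
Qed.

(** This makes the action of gl(P) on L(1, a, b) a morphism in Ver_4^+. *)
Lemma Lmx_dif A : gl_dif (Lmx A) = Lmx (gl_dif A).
Proof.
have two0 : (2%:R : k) = 0 by rewrite (pcharf0 char2).
by rewrite (mx2_eta A) mx2_dif !Lmx_mx2 mx2_dif; congr mx2;
  apply: (addr0_eq_char2 char2); ring: two0.
Qed.

(** The defining relation of U(gl(P)) holds for the matrices [Lmx], so they
    extend to a representation of U(gl(P)). *)
Lemma Lmx_env A B :
  Lmx A * Lmx B - Lmx B * Lmx A - Lmx (gl_dif B) * Lmx (gl_dif A)
  = Lmx (gl_br A B).
Proof.
have two0 : (2%:R : k) = 0 by rewrite (pcharf0 char2).
have four0 : (4%:R : k) = 0 by rewrite (natrM _ 2 2) two0 mul0r.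
have six0 : (6%:R : k) = 0 by rewrite (natrM _ 2 3) two0 mul0r.
rewrite -!Lmx_dif (mx2_eta A) (mx2_eta B) /gl_br !Lmx_mx2 !mx2_dif.
rewrite !(mx2N, mx2D, mx2M) Lmx_mx2 !(oppr_pchar2 char2); congr mx2.
(* The entries of both sides add up to polynomials in which every coefficient
   is 2, 4 or 6. *)
all: by apply: (addr0_eq_char2 char2); ring: two0 four0 six0.
Qed.

Lemma Lmx_e : Lmx (gl_e k) = 1.
Proof.
have two0 : (2%:R : k) = 0 by rewrite (pcharf0 char2).
by rewrite /gl_e -!mx2_1 Lmx_mx2; congr mx2;
  apply: (addr0_eq_char2 char2); ring: two0.
Qed.

Definition Lrho (u : Ugl k) : 'M[k]_2 := teval Lmx (Urep u).

Lemma Lrho_cls t : Lrho (Ucls t) = teval Lmx t.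
Proof. exact: (teval_rel Lmx_linear Lmx_env (Urep_cls t)). Qed.

Lemma Lrho_gen A : Lrho (Ugen A) = Lmx A.
Proof. exact: Lrho_cls. Qed.

Lemma Lrho_alg c : Lrho c%:A = c%:A.
Proof. by rewrite -Ucst_alg Lrho_cls. Qed.

Lemma LrhoD u v : Lrho (u + v) = Lrho u + Lrho v.
Proof. by rewrite -(UrepK u) -(UrepK v) -UclsD !Lrho_cls. Qed.

Lemma LrhoM u v : Lrho (u * v) = Lrho u * Lrho v.
Proof. by rewrite -(UrepK u) -(UrepK v) -UclsM !Lrho_cls. Qed.

Lemma LrhoZ c u : Lrho (c *: u) = c *: Lrho u.
Proof. by rewrite -mulr_algl LrhoM Lrho_alg mulr_algl. Qed.

Lemma Lrho_dif u : Lrho (Udif u) = gl_dif (Lrho u).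
Proof.
elim/Uind: u => [A|c|u v Eu Ev|u v Eu Ev].
- by rewrite Udif_gen // !Lrho_gen Lmx_dif.
- rewrite Udif_alg // -(scale0r 1) !Lrho_alg scale0r.
  by rewrite /gl_dif mulr_algl mulr_algr -scalerDr (char2_addvv char2) scaler0.
- by rewrite UdifD // !LrhoD Eu Ev linearD.
- by rewrite UdifM // LrhoD !LrhoM Eu Ev gl_difM.
Qed.

Definition Lact (u : A1ver char2) (v : P k) : P k := Lrho (A1val u) *m v.

Definition Lmod : verMod (A1ver char2) (P k).
Proof.
exists Lact => [v c u1 u2|u c v1 v2|v|u1 u2 v|u v]; rewrite /Lact.
- by rewrite LrhoD LrhoZ mulmxDl scalemxAl.
- by rewrite mulmxDr scalemxAr.
- by rewrite Lrho_gen Lmx_e mul1mx.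
- by rewrite LrhoM mulmxA.
- rewrite /= Lrho_dif /gl_dif mulmxDl -!mulmxA.
  by rewrite (@char2_addvK _ char2).
Defined.

Lemma Lmod_gen A v : Lmod (A1gen char2 A) v = Lmx A *m v.
Proof. by rewrite /= /Lact /= LrhoM !Lrho_gen Lmx_e mulr1. Qed.

Lemma Lmod_y v : Lmod (A1gen char2 (gl_y k)) v = mx2 b 0 0 (b + 1) *m v.
Proof. by rewrite Lmod_gen Lmx_mx2; congr (mx2 _ _ _ _ *m _); ring. Qed.

Lemma Lmod_x v : Lmod (A1gen char2 (gl_x k)) v = mx2 0 1 a 0 *m v.
Proof. by rewrite Lmod_gen Lmx_mx2; congr (mx2 _ _ _ _ *m _); ring. Qed.

Lemma Lmod_n v : Lmod (A1gen char2 (gl_y' k)) v = mx2 0 0 1 0 *m v.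
Proof. by rewrite Lmod_gen Lmx_mx2; congr (mx2 _ _ _ _ *m _); ring. Qed.

End ModuleL.

(** * The algebra A_1 *)

Section AlgebraA1.
Variables (k : fieldType) (char2 : 2%N \in [pchar k]).
Local Notation A1 := (A1ver char2).

(** Multiplication by the central idempotent e is a morphism of algebras onto
    A_1; all relations in A_1 are obtained by transporting those of U(gl(P))
    along it. *)
Definition A1proj (u : Ugl k) : A1 :=
  @MkA1 k char2 (u * Ue k) (A1proj_subproof (char2 := char2) u).

Lemma A1proj_linear : linear A1proj.
Proof. by move=> c u v; apply/val_inj; rewrite /= mulrDl scalerAl. Qed.

HB.instance Definition _ :=
  GRing.isLinear.Build k (Ugl k) A1 _ A1proj A1proj_linear.

Lemma A1projM u v : A1proj (u * v) = A1proj u * A1proj v.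
Proof.
apply/val_inj; rewrite /= -[RHS]mulrA (mulrA (Ue k)) (Ue_comm char2).
by rewrite -(mulrA v) Ue_idem mulrA.
Qed.

Lemma A1proj1 : A1proj 1 = 1.
Proof. by apply/val_inj; rewrite /= mul1r. Qed.

Lemma A1proj_val (u : A1) : A1proj (A1val u) = u.
Proof. by apply/val_inj/in_A1P/A1P. Qed.

Lemma A1gen_linear : linear (A1gen char2).
Proof.
move=> c A B; rewrite -[LHS]/(A1proj _) linearP.
exact: (linearP A1proj).
Qed.

HB.instance Definition _ :=
  GRing.isLinear.Build k 'M[k]_2 A1 _ (A1gen char2) A1gen_linear.

Lemma A1gen_env A B :
  A1gen char2 A * A1gen char2 B + A1gen char2 B * A1gen char2 A
  = A1gen char2 (gl_br A B) + A1gen char2 (gl_dif B) * A1gen char2 (gl_dif A).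
Proof.
rewrite -[A1gen _ (gl_br A B)]/(A1proj _) -Ugen_env 2!linearB /= !A1projM.
by rewrite subrK (char2_oppv char2).
Qed.

Lemma A1dif_gen A : adif A1 (A1gen char2 A) = A1gen char2 (gl_dif A).
Proof.
apply/val_inj; rewrite /= (UdifM char2) (Udif_gen char2) Udif_e //.
by rewrite mulr0 addr0.
Qed.

Local Notation x := (A1gen char2 (gl_x k)).
Local Notation y := (A1gen char2 (gl_y k)).
Local Notation n := (A1gen char2 (gl_y' k)).

Lemma A1gen_e : A1gen char2 (gl_e k) = 1.
Proof. by apply/val_inj; exact: Ue_idem. Qed.

Let gl_dif_y : gl_dif (gl_y k) = gl_y' k.
Proof. by rewrite mx2_dif addr0. Qed.

Let gl_dif_y' : gl_dif (gl_y' k) = 0.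
Proof. by rewrite -gl_dif_y (gl_difK char2). Qed.

Lemma A1_xn : x * n + n * x = 1.
Proof.
rewrite A1gen_env gl_dif_y' linear0 mul0r addr0 -A1gen_e; congr A1gen.
rewrite /gl_br gl_dif_y' mul0r subr0 !mx2M mx2N mx2D /gl_e -mx2_1.
by congr mx2; rewrite !(oppr_pchar2 char2); ring.
Qed.

Lemma A1_yn : y * n + n * y = n.
Proof.
rewrite A1gen_env gl_dif_y' linear0 mul0r addr0; congr A1gen.
rewrite /gl_br gl_dif_y' mul0r subr0 !mx2M mx2N mx2D.
by congr mx2; rewrite !(oppr_pchar2 char2); ring.
Qed.

Lemma A1_xy : x * y + y * x = x.
Proof.
rewrite A1gen_env gl_dif_x gl_dif_y A1gen_e mulr1 -linearD; congr A1gen.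
rewrite /gl_br gl_dif_x gl_dif_y mulr1 !mx2M !mx2N !mx2D.
rewrite !(oppr_pchar2 char2).
by congr mx2; rewrite ?(addrK_pchar2 char2) //; ring.
Qed.

(** The relation for the pair (y, y): the commutator and the bracket vanish, and
    only the braiding term y' y' is left. *)
Lemma A1_nn : n * n = 0.
Proof.
have := A1gen_env (gl_y k) (gl_y k).
rewrite (char2_addvv char2) gl_dif_y /gl_br gl_dif_y !mx2M !mx2N !mx2D.
rewrite !(mulr0, mul0r, addr0, mulr1, oppr0, subrr).
by rewrite mx2_0 linear0 add0r.
Qed.

Lemma A1gen_basis A :
  A1gen char2 A =
  A 0 0 *: y + A 0 1 *: x + A 1 0 *: n + A 1 1 *: (1 - y).
Proof.
rewrite -A1gen_e -linearB -!linearZ -!linearD; congr A1gen.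
rewrite /gl_e -mx2_1 {1}(mx2_eta A) !(mx2N, mx2D, mx2Z).
by congr mx2; ring.
Qed.

(** The elements x, y and n generate A_1 because E_22 = e - y and e is the unit
    of A_1. *)
Lemma A1_ind (Q : A1 -> Prop) :
  Q x -> Q y -> Q n -> Q 1 ->
  (forall c u v, Q u -> Q v -> Q (c *: u + v)) ->
  (forall u v, Q u -> Q v -> Q (u * v)) -> forall u, Q u.
Proof.
move=> Qx Qy Qn Q1 QD QM.
have Q0 : Q 0 by rewrite -(addNr 1) -scaleN1r; apply: QD.
have QZ c u : Q u -> Q (c *: u).
  by move=> Qu; rewrite -[_ *: u]addr0; apply: QD.
move=> u; rewrite -(A1proj_val u).
elim/Uind: (A1val u) => [A|c|{}u v Qu Qv|{}u v Qu Qv].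
- rewrite -[A1proj _]/(A1gen char2 A) A1gen_basis -!addrA.
  do 3 ! apply: (QD) => //.
  by apply: QZ; rewrite addrC -scaleN1r; apply: QD.
- by rewrite linearZ /= A1proj1; apply: QZ.
- by rewrite linearD /= -[A1proj u]scale1r; apply: QD.
- by rewrite A1projM; apply: QM.
Qed.

Lemma A1_central z :
  GRing.comm z x -> GRing.comm z y -> GRing.comm z n ->
  forall u, GRing.comm z u.
Proof.
move=> zx zy zn u; elim/A1_ind: u => // [|c u v zu zv|u v zu zv].
- exact: commr1.
- by apply: commrD => //; rewrite /GRing.comm -scalerAr zu scalerAl.
- exact: commrM.
Qed.

(** In characteristic 2 one has [x^2, u] = [x, [x, u]], and
    [x, [x, y]] = [x, x] = 0 while [x, [x, n]] = [x, 1] = 0. *)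
Lemma A1_casimir_x u : GRing.comm (x * x) u.
Proof.
apply: A1_central; rewrite /GRing.comm.
- by rewrite mulrA.
- have yx := char2_addv_eq char2 (etrans (addrC _ _) A1_xy).
  rewrite mulrA yx mulrDl -(mulrA x y x) yx mulrDr mulrA.
  by rewrite (char2_addKv char2).
- have nx := char2_addv_eq char2 (etrans (addrC _ _) A1_xn).
  rewrite [RHS]mulrA nx mulrDl mul1r -(mulrA x n x) nx mulrDr mulr1 mulrA.
  by rewrite (char2_addKv char2).
Qed.

(** The commutators of n x with x and n, namely [n x, x] = [n, x] x = x and
    [n x, n] = n [x, n] = n, are those of y, and n x commutes with y. *)
Lemma A1_casimir_y u : GRing.comm (y + n * x) u.
Proof.
have xn := char2_addv_eq char2 A1_xn.
have xy := char2_addv_eq char2 A1_xy.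
have yn := char2_addv_eq char2 A1_yn.
apply: A1_central; rewrite /GRing.comm mulrDl mulrDr.
- by rewrite !mulrA xn mulrDl mul1r xy addrACA (char2_addvv char2) add0r.
- by rewrite -!mulrA xy mulrDr !mulrA yn mulrDl.
- rewrite -!mulrA xn mulrDr mulr1 !mulrA A1_nn mul0r yn !addr0.
  by rewrite addrAC (char2_addvv char2) add0r.
Qed.

(** Both sides are derivations, so that x, y and n suffice; there the claim is
    [n, x] = 1 = dx, [n, y] = n = dy and [n, n] = 0 = dn. *)
Lemma A1_dif_inner u : adif A1 u = n * u + u * n.
Proof.
elim/A1_ind: u => [||||c u v Eu Ev|u v Eu Ev].
- by rewrite A1dif_gen gl_dif_x A1gen_e addrC A1_xn.
- by rewrite A1dif_gen gl_dif_y addrC A1_yn.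
- by rewrite A1dif_gen gl_dif_y' linear0 A1_nn addr0.
- rewrite -A1gen_e A1dif_gen gl_dif_e // linear0 A1gen_e mulr1 mul1r.
  by rewrite (char2_addvv char2).
- rewrite linearP Eu Ev mulrDr mulrDl scalerDr -scalerAr -scalerAl.
  by rewrite addrACA.
- rewrite adifM Eu Ev mulrDl mulrDr !mulrA addrA; congr (_ + _).
  by rewrite (char2_addvK char2).
Qed.

End AlgebraA1.

(** * Schur's lemma *)

HB.instance Definition _ (k : fieldType) (A : verAlg k) (V : verObj k)
    (M : verMod A V) (u : A) :=
  GRing.isLinear.Build k V V _ (mact M u) (mact_linear_r M u).

Definition intertwines (k : fieldType) (A : verAlg k) (V W : verObj k)
    (M : verMod A V) (N : verMod A W) (f : V -> W) : Prop :=
  (forall v, f (vdif V v) = vdif W (f v)) /\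
  (forall u v, f (M u v) = N u (f v)).

Section Schur.
Variables (k : fieldType) (A : verAlg k) (V W : verObj k).
Variables (M : verMod A V) (N : verMod A W).

Lemma mactDl u1 u2 v : M (u1 + u2) v = M u1 v + M u2 v.
Proof. by have := mact_linear_l M v 1 u1 u2; rewrite !scale1r. Qed.

Lemma mact0l v : M 0 v = 0.
Proof. by apply: (addrI (M 0 v)); rewrite -mactDl !addr0. Qed.

Lemma simple_neq0 : simple_module M -> exists v : V, v != 0.
Proof.
case=> nzV _; exists (vpick (fullv : {vspace V})).
by rewrite vpick0; apply/eqP.
Qed.

(** The kernel of a morphism is a submodule. *)
Lemma simple_intertwines_inj (f : {linear V -> W}) :
  simple_module M -> intertwines M N f -> (exists v, f v != 0) -> injective f.
Proof.
move=> [_ simM] [fD fA] [v fv0].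
have kerE w : (w \in lker (linfun f)) = (f w == 0) by rewrite memv_ker lfunE.
have /simM [ker0|kerT] : submodule M (lker (linfun f)).
- by split=> [w|u w]; rewrite !kerE ?fD ?fA => /eqP ->; rewrite linear0.
- move=> w1 w2 /eqP; rewrite -subr_eq0 -linearB -kerE ker0 memv0 subr_eq0.
  by move/eqP.
- by move: fv0; rewrite -kerE kerT memvf.
Qed.

(** The image of a morphism is a submodule. *)
Lemma simple_intertwines_surj (f : {linear V -> W}) :
  simple_module N -> intertwines M N f -> (exists v, f v != 0) ->
  forall w, exists v, f v = w.
Proof.
move=> [_ simN] [fD fA] [v fv0] w.
have imP w' : reflect (exists v', f v' = w') (w' \in limg (linfun f)).
  apply: (iffP memv_imgP) => [[v' _ ->]|[v' <-]].
    by exists v'; rewrite lfunE.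
  by exists v'; rewrite ?memvf ?lfunE.
have /simN [im0|imT] : submodule N (limg (linfun f)).
- split=> [w'|u w'] /imP [v' <-]; apply/imP.
    by exists (vdif V v').
  by exists (M u v').
- have : f v \in limg (linfun f) by apply/imP; exists v.
  by rewrite im0 memv0 (negPf fv0).
- by apply/imP; rewrite imT memvf.
Qed.

Lemma simple_intertwines_iso (f : {linear V -> W}) :
  simple_module M -> simple_module N -> intertwines M N f ->
  (exists v, f v != 0) -> module_iso N M.
Proof.
move=> simM simN fM nzf; have [fD fA] := fM.
have f_inj := simple_intertwines_inj simM fM nzf.
have f_surj := simple_intertwines_surj simN fM nzf.
pose g : 'Hom(W, V) := (linfun f)^-1%VF.
have fK : cancel f g.
  move=> v; rewrite -[f v](lfunE f); apply: lker0_lfunK.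
  by apply/lker0P => v1 v2; rewrite !lfunE; apply: f_inj.
have gK : cancel g f by move=> w; have [v <-] := f_surj w; rewrite fK.
exists g; split=> [|w|u w]; first by exists f.
  by apply: f_inj; rewrite gK fD gK.
by apply: f_inj; rewrite gK fA gK.
Qed.

End Schur.

Import VectorInternalTheory.

Lemma exists_eigenvector (k : closedFieldType) (V : vectType k)
    (f : {linear V -> V}) :
  (exists v : V, v != 0) -> exists c v, v != 0 /\ f v = c *: v.
Proof.
move=> [v0 nzv0]; pose F := lin1_mx (v2r \o f \o r2v).
have /closed_rootP [c] : size (char_poly F) != 1.
  rewrite size_char_poly eqSS; apply: contra nzv0 => /eqP dim0.
  rewrite -(can_eq v2rK) linear0; apply/eqP/matrixP => i [j ltj].
  by exfalso; move: ltj; rewrite dim0.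
rewrite -eigenvalue_root_char => /eigenvalueP [v vF nzv].
exists c, (r2v v); split; first by rewrite -(linear0 r2v) (can_eq r2vK).
by apply: (can_inj v2rK); rewrite linearZ /= r2vK -vF mul_rV_lin1.
Qed.

(** The difference of z and one of its eigenvalues is a non-injective
    endomorphism of M, hence zero.  The condition on the differential of z is
    what makes this difference commute with d. *)
Lemma simple_central_scalar (k : closedFieldType) (A : verAlg k)
    (V : verObj k) (M : verMod A V) (z : A) :
  simple_module M -> (forall u, GRing.comm z u) -> adif A z = 0 ->
  exists c, forall v, M z v = c *: v.
Proof.
move=> simM zC dz.
have [c [w [nzw zw]]] := exists_eigenvector (mact M z) (simple_neq0 simM).
exists c => v; pose g : 'End(V) := linfun (mact M z) - c *: \1%VF.
have gE u : g u = M z u - c *: u.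
  by rewrite /g add_lfunE opp_lfunE scale_lfunE id_lfunE lfunE.
have gM : intertwines M M g.
  split=> [u|u1 u]; rewrite !gE linearB.
    by rewrite (linearZZ (vdif V)) /= mact_dif dz mact0l add0r.
  by rewrite (linearZZ (mact M u1)) /= -!mactM zC.
have [gv0|gvN0] := eqVneq (g v) 0.
  by apply/eqP; rewrite -subr_eq0 -gE gv0.
have g_inj := simple_intertwines_inj simM gM (ex_intro _ v gvN0).
have gw : g w = 0 by rewrite gE zw subrr.
by case/eqP: nzw; apply: g_inj; rewrite linear0; exact: gw.
Qed.

(** * Simple A_1-modules *)

Section SimpleA1.
Variables (k : fieldType) (char2 : 2%N \in [pchar k]).
Local Notation A1 := (A1ver char2).
Local Notation x := (A1gen char2 (gl_x k)).
Local Notation y := (A1gen char2 (gl_y k)).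
Local Notation n := (A1gen char2 (gl_y' k)).

Lemma A1_intertwines (V W : verObj k) (M : verMod A1 V) (N : verMod A1 W)
    (f : {linear V -> W}) :
  (forall v, f (vdif V v) = vdif W (f v)) ->
  (forall v, f (M x v) = N x (f v)) -> (forall v, f (M y v) = N y (f v)) ->
  (forall v, f (M n v) = N n (f v)) -> intertwines M N f.
Proof.
move=> fD fx fy fn; split=> // u.
elim/A1_ind: u => // [v|c u1 u2 E1 E2 v|u1 u2 E1 E2 v].
- by rewrite !mact1.
- by rewrite !mact_linear_l linearP E1 E2.
- by rewrite !mactM E1 E2.
Qed.

(** As d is inner on A_1, central elements automatically satisfy the hypothesis
    of [simple_central_scalar]. *)
Lemma A1_dif_central z : (forall u, GRing.comm z u) -> adif A1 z = 0.
Proof. by move=> zC; rewrite A1_dif_inner zC (char2_addvv char2). Qed.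

(** The operator T = d + n is a module endomorphism because d is inner on A_1;
    its square is zero, so it cannot be injective on V != 0. *)
Lemma simple_A1_dif (V : verObj k) (M : verMod A1 V) :
  simple_module M -> forall v, vdif V v = M n v.
Proof.
move=> simM.
pose T : 'End(V) := linfun (vdif V) + linfun (mact M n).
have TE u : T u = vdif V u + M n u by rewrite /T add_lfunE !lfunE.
have Dn u : vdif V (M n u) = M n (vdif V u).
  by rewrite mact_dif A1_dif_inner (char2_addvv char2) mact0l add0r.
have TM : intertwines M M T.
  split=> [u|u1 u]; rewrite !TE linearD /=; first by rewrite Dn.
  rewrite mact_dif A1_dif_inner mactDl !mactM addrC addrA.
  by rewrite (char2_addKv char2) addrC.
have TT u : T (T u) = 0.
  rewrite !TE !linearD /= vdifK Dn -mactM A1_nn mact0l add0r addr0.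
  exact: (char2_addvv char2).
move=> v; suff: T v = 0.
  by rewrite TE => /(char2_addv_eq char2) ->; rewrite add0r.
apply/eqP; apply: contraT => nzTv.
have T_inj := simple_intertwines_inj simM TM (ex_intro _ v nzTv).
by case/eqP: nzTv; apply: T_inj; rewrite linear0; exact: TT.
Qed.

Lemma vdif_P (p : P k) : vdif (P k) p = mx2 0 0 1 0 *m p.
Proof. by []. Qed.

(** A nonzero submodule contains the second basis vector w, up to scaling: take
    v itself if its first coordinate vanishes and d v otherwise.  The action of
    x then gives the first basis vector. *)
Lemma Lmod_simple a b : simple_module (Lmod char2 a b).
Proof.
split.
  move=> P0; have /eqP : (const_mx 1 : P k) = 0.
    by apply/eqP; rewrite -memv0 -P0 memvf.
  by move/eqP/matrixP/(_ 0 0)/eqP; rewrite !mxE oner_eq0.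
move=> W [WD WA].
have [W0|nzW] := eqVneq W 0%VS; [by left|right].
have [w [Ww w0 w1]] : exists w : P k, [/\ w \in W, w 0 0 = 0 & w 1 0 = 1].
  have nzv : vpick W != 0 by rewrite vpick0.
  have Wv := memv_pick W; set v := vpick W in nzv Wv.
  have [v0|nzv0] := eqVneq (v 0 0) 0.
    have nzv1 : v 1 0 != 0.
      by apply: contra nzv => /eqP v1; apply/eqP/cV2P; rewrite !mxE.
    exists ((v 1 0)^-1 *: v); split; first exact: memvZ.
      by rewrite mxE v0 mulr0.
    by rewrite mxE mulVf.
  exists ((v 0 0)^-1 *: vdif (P k) v); split; first by apply/memvZ/WD.
    by rewrite mxE vdif_P mulmx_mx2 !mul0r addr0 mulr0.
  by rewrite mxE vdif_P mulmx_mx2 mul0r addr0 mul1r mulVf.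
apply/eqP; rewrite eqEsubv subvf; apply/subvP => p _.
have -> : p = p 0 0 *: Lmod char2 a b x w + p 1 0 *: w.
  rewrite Lmod_gen Lmx_mx2.
  apply: cV2P; rewrite [RHS]mxE [X in X + _]mxE [X in _ + X]mxE mulmx_mx2.
    by rewrite w0 w1; ring.
  by rewrite w0 w1; ring.
by rewrite memvD // memvZ // WA.
Qed.

End SimpleA1.

(** * Classification *)

Section Classification.
Variables (k : closedFieldType) (char2 : 2%N \in [pchar k]).
Local Notation A1 := (A1ver char2).
Local Notation x := (A1gen char2 (gl_x k)).
Local Notation y := (A1gen char2 (gl_y k)).
Local Notation n := (A1gen char2 (gl_y' k)).

(** With d acting as n, the vector v in the kernel of n plays the role of the
    second basis vector d of P, and x v that of the first one. *)
Lemma simple_A1_iso (V : verObj k) (M : verMod A1 V) :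
  simple_module M -> exists a b, module_iso M (Lmod char2 a b).
Proof.
move=> simM; have VD := simple_A1_dif simM.
have [a xx] := simple_central_scalar simM (@A1_casimir_x k char2)
  (A1_dif_central (@A1_casimir_x k char2)).
have [b ynx] := simple_central_scalar simM (@A1_casimir_y k char2)
  (A1_dif_central (@A1_casimir_y k char2)).
have [v [nzv nv]] : exists v, v != 0 /\ M n v = 0.
  have [w nzw] := simple_neq0 simM; have [nw|nznw] := eqVneq (M n w) 0.
    by exists w.
  by exists (M n w); rewrite -mactM A1_nn mact0l.
have nxE u : M n (M x u) = u + M x (M n u).
  rewrite -!mactM -[X in X + _](mact1 M) -(A1_xn char2) mactDl addrC.
  by rewrite (char2_addKv char2).
have yE u : M y u = b *: u + M n (M x u).
  by rewrite -ynx mactDl mactM (char2_addvK char2).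
have xxE u : M x (M x u) = a *: u by rewrite -mactM.
have nxv : M n (M x v) = v by rewrite nxE nv linear0 addr0.
pose f (p : P k) : V := p 0 0 *: M x v + p 1 0 *: v.
have f_linear : linear f.
  move=> c p q; rewrite /f !mxE !scalerDl scalerDr !scalerA.
  by rewrite addrACA.
pose F : {linear P k -> V} :=
  HB.pack f (GRing.isLinear.Build k (P k) V _ f f_linear).
have fM : intertwines (Lmod char2 a b) M F.
  have fn p : F (Lmod char2 a b n p) = M n (F p).
    rewrite Lmod_n /= /f !mulmx_mx2 linearD !linearZZ /= nxv nv.
    by rewrite !mul0r mul1r !addr0 scale0r add0r scaler0 addr0.
  apply: A1_intertwines => // p.
  - by rewrite VD -fn Lmod_n.
  - rewrite Lmod_x /= /f !mulmx_mx2 linearD !linearZZ /= xxE scalerA.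
    by rewrite !mul0r mul1r add0r addr0 addrC mulrC.
  - rewrite Lmod_y /= /f !mulmx_mx2 linearD !linearZZ /= !yE nxv xxE.
    rewrite linearZZ /= nv scaler0 addr0 !mul0r add0r addr0.
    by rewrite mulrDl mul1r scalerDl scalerDr !scalerA ![b * _]mulrC.
exists a, b; apply: (simple_intertwines_iso (Lmod_simple char2 a b) simM fM).
(* The second basis vector of P is sent to v != 0. *)
exists (\col_i (i == 1)%:R); rewrite /= /f !mxE /= scale0r add0r.
by rewrite scale1r.
Qed.

(** The parameters are recovered as the scalars by which the central elements
    x^2 and y + n x act. *)
Lemma Lmod_iso_inj a b a' b' :
  module_iso (Lmod char2 a b) (Lmod char2 a' b') -> a = a' /\ b = b'.
Proof.
case=> f [f_bij _ fA].
pose p : P k := const_mx 1.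
have nzfp : f p != 0.
  rewrite -(linear0 f) (inj_eq (bij_inj f_bij)).
  by apply/eqP => /matrixP/(_ 0 0)/eqP; rewrite !mxE oner_eq0.
have scal (z : A1) (c c' : k) :
    (forall q, Lmod char2 a b z q = c *: q) ->
    (forall q, Lmod char2 a' b' z q = c' *: q) -> c = c'.
  move=> zc zc'; have := fA z p; rewrite zc zc' linearZZ.
  move/eqP; rewrite -subr_eq0 -scalerBl scaler_eq0 (negPf nzfp) orbF subr_eq0.
  by move/eqP.
have two0 : (2%:R : k) = 0 by rewrite (pcharf0 char2).
split.
  by apply: (scal (x * x)) => q; rewrite mactM !Lmod_x;
    apply: cV2P; rewrite [RHS]mxE !mulmx_mx2; ring.
by apply: (scal (y + n * x)) => q; rewrite mactDl mactM Lmod_y Lmod_x Lmod_n;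
  apply: cV2P; rewrite [LHS]mxE [RHS]mxE !mulmx_mx2;
  apply: (addr0_eq_char2 char2); ring: two0.
Qed.

End Classification.

Theorem proposition7p6 (k : closedFieldType) (char2 : 2%N \in [pchar k]) :
  exists L : k -> k -> verMod (A1ver char2) (P k),
    [/\ forall (a b : k) (v : P k),
          [/\ L a b (A1gen char2 (gl_y k)) v = mx2 b 0 0 (b + 1) *m v,
              L a b (A1gen char2 (gl_x k)) v = mx2 0 1 a 0 *m v,
              L a b (A1gen char2 (gl_y' k)) v = mx2 0 0 1 0 *m v
            & L a b (A1gen char2 (gl_e k)) v = v],
        forall a b : k, simple_module (L a b),
        forall (V : verObj k) (M : verMod (A1ver char2) V),
          simple_module M -> exists a b : k, module_iso M (L a b)
      & forall a b a' b' : k,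
          module_iso (L a b) (L a' b') -> a = a' /\ b = b'].
Proof.
exists (Lmod char2); split.
- by move=> a b v; rewrite Lmod_y Lmod_x Lmod_n A1gen_e mact1.
- exact: Lmod_simple.
- exact: simple_A1_iso.
- exact: Lmod_iso_inj.
Qed.
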